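(* Let $n\ge3$ and let $\mathbf u$ be a subsonic Largely-open Nozzle Far Field Flow in $\Omega^{\mathcal N}\subset\mathbb R^n$ with mass flux $m>0$ (as defined in the context). Let $\Lambda>0$ be a constant with $\rho\le\Lambda$, and for $r>0$ let $S_r=\mathcal C_+\cap\partial B_r(A_+)$. Then for every sufficiently large $r$ there exists a point $\bar{\mathbf x}_r\in S_r$ such that $$\Lambda\,|\mathbf u(\bar{\mathbf x}_r)|\ \ge\ \frac{m}{|\Sigma_+|}\,|\bar{\mathbf x}_r-A_+|^{1-n}.$$ (In particular, since $\mathbf u^\infty=\mathbf 0$, the decay rate $|\mathbf x|^{-n+1}$ for $|\mathbf u-\mathbf u^\infty|$ cannot be improved.)
   Context: The pressure $p=p(\rho)$ is a function in $C([0,\infty))\cap C^2((0,\infty))$ with $p'(\rho)>0$ and $2p'(\rho)+\rho p''(\rho)>0$ for $\rho>0$. The enthalpy $h$ is defined by $h'(\rho)=p'(\rho)/\rho$, and $c(\rho)=\sqrt{p'(\rho)}$. For a fixed constant $B$, consider the system for velocity $\mathbf u=(u_1,\dots,u_n)$ and density $\rho>0$ $$\operatorname{div}(\rho\mathbf u)=0,\qquad \operatorname{curl}\mathbf u=0\ (\text{i.e. }\partial_iu_j=\partial_ju_i),\qquad \tfrac12|\mathbf u|^2+h(\rho)\equiv B, \tag{E}$$ so that $\rho=\rho(|\mathbf u|^2)$. The critical speed $q_{cr}$ is such that $|\mathbf u|<q_{cr}$ iff $|\mathbf u|<c(\rho)$; the flow is subsonic if $\sup|\mathbf u|<q_{cr}$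 on its domain. Solutions are classical (regular up to the wall). $\Omega^{\mathcal N}\subset\mathbb R^n$ is a domain composed of a divergent part $\mathcal C_+$, a convergent part $\mathcal C_-$ and a bounded throat $\mathcal T$ connecting them, with $C^{2,\alpha}$ boundary ($0<\alpha<1$). Here $\mathcal C_\pm=\{A_\pm+r\omega:\omega\in\Sigma_\pm,\ r>r_\pm\}$ (for some $r_\pm>0$) is an infinitely long part of a cone with vertex $A_\pm$, where $\Sigma_\pm$ is a connected smooth part of the unit sphere $\mathbb S^{n-1}$; $|\Sigma_+|$ denotes its $(n-1)$-dimensional surface measure. A Largely-open Nozzle Far Field Flow is a solution $\mathbf u$ of (E) in $\Omega^{\mathcal N}\cap\{|\mathbf x|\ge R_1\}$, for some sufficiently large $R_1>0$, with $\mathbf u\cdot\mathbf n=0$ on $\partial\Omega^{\mathcal N}\cap\{|\mathbf x|\ge R_1\}$ ($\mathbf n$ the unit outward normal) and $\int_{\mathcal S_0}\rho\,\mathbf u\cdot\mathbf l\,ds=m$ for every cross-section $\mathcal S_0$ of the nozzle, $\mathbf l$ being the unit normal of $\mathcal S_0$ pointing downstream (from the $\mathcal C_-$ end towards the $\mathcal C_+$ end) and $m>0$ a constant. In particular $\int_{S_r}\rho\,\mathbf u\cdot\mathbf l\,ds=m$ with $\mathbf l=(\mathbf x-A_+)/r$ for large $r$. The state at infinity is $\mathbf u^\infty=\mathbf 0$. *)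

(* Defs.v *)
From HB Require Import structures.
From mathcomp Require Import all_boot all_order all_algebra.
From mathcomp Require Import all_classical all_reals all_analysis.

Set Implicit Arguments.
Unset Strict Implicit.
Unset Printing Implicit Defensive.

Import Order.TTheory GRing.Theory Num.Theory.
Import numFieldNormedType.Exports.

Local Open Scope classical_set_scope.
Local Open Scope ring_scope.

(* The library norm on row vectors is the sup norm, so the Euclidean norm is
   introduced separately (both define the same topology). *)
Definition dotv (R : realType) (n : nat) (x y : 'rV[R]_n) : R :=
  \sum_(i < n) x 0 i * y 0 i.

Definition enorm (R : realType) (n : nat) (x : 'rV[R]_n) : R :=
  Num.sqrt (dotv x x).

Definition esphere (R : realType) (n : nat) (a : 'rV[R]_n) (r : R) :
    set 'rV[R]_n :=
  [set x | enorm (x - a) = r].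

(* Volume of the unit ball of R^k, from V_0 = 1, V_1 = 2 and
   V_k = (2 pi / k) V_(k-2).  With this normalisation the k-dimensional
   Hausdorff measure is the usual k-dimensional surface measure. *)
Fixpoint unit_ball_volume (R : realType) (k : nat) : R :=
  match k with
  | 0 => 1
  | 1 => 2
  | (k'.+2) as k => 2 * pi / k%:R * unit_ball_volume R k'
  end.

Section hausdorff.
Variables (R : realType) (n : nat).
Implicit Types (A : set 'rV[R]_n) (F : (set 'rV[R]_n)^nat).

Definition diam_le (d : R) A : Prop :=
  forall x y, A x -> A y -> enorm (x - y) <= d.

(* The real supremum [sup] is only meaningful for nonempty bounded sets: it is
   used below on sets satisfying [diam_le d], and the empty set is handled
   apart in [hausdorff_weight] (which matters for k = 0 only). *)
Definition diam A : R :=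
  sup [set t | exists x y, [/\ A x, A y & t = enorm (x - y)]].

Definition hausdorff_weight (k : nat) A : R :=
  if asbool (A = set0) then 0 else unit_ball_volume R k * (diam A / 2) ^+ k.

Definition hausdorff_cover (d : R) A : set ((set 'rV[R]_n)^nat) :=
  [set F | A `<=` \bigcup_i F i /\ forall i, diam_le d (F i)].

Definition hausdorff_content (k : nat) (d : R) A : \bar R :=
  ereal_inf [set (\sum_(i <oo) (hausdorff_weight k (F i))%:E)%E
            | F in hausdorff_cover d A].

Definition hausdorff (k : nat) A : \bar R :=
  ereal_sup [set hausdorff_content k d A | d in [set d : R | 0 < d]].

Lemma dotv_ge0 (x : 'rV[R]_n) : 0 <= dotv x x.
Proof. by apply: sumr_ge0 => i _; rewrite -expr2 sqr_ge0. Qed.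

Lemma unit_ball_volume_ge0 k : 0 <= unit_ball_volume R k.
Proof.
suff: 0 <= unit_ball_volume R k /\ 0 <= unit_ball_volume R k.+1 by case.
elim: k => [|k [h1 h2]]; split => //=.
by rewrite mulr_ge0 // divr_ge0 ?ler0n // mulr_ge0 // pi_ge0.
Qed.

Lemma diam_ge0 A : 0 <= diam A.
Proof.
rewrite /diam; set E := (X in sup X).
have [[[t Et] ubE]|/sup_out ->//] := pselect (has_sup E).
apply: (@le_trans _ _ t); last exact: ub_le_sup.
by case: Et => [x [y [_ _ ->]]]; exact: sqrtr_ge0.
Qed.

Lemma hausdorff_weight_ge0 k A : 0 <= hausdorff_weight k A.
Proof.
rewrite /hausdorff_weight; case: ifP => // _.
by rewrite mulr_ge0 ?unit_ball_volume_ge0 // exprn_ge0 // divr_ge0 ?diam_ge0.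
Qed.

Lemma hausdorff_weight0 k : hausdorff_weight k set0 = 0.
Proof. by rewrite /hausdorff_weight; case: ifP => // /asboolP. Qed.

Local Open Scope ereal_scope.

Lemma hausdorff_content_ge0 k d A : 0 <= hausdorff_content k d A.
Proof.
apply: le_ereal_inf_tmp => _ [F _ <-]; apply: nneseries_ge0 => i _ _.
by rewrite lee_fin hausdorff_weight_ge0.
Qed.

Lemma hausdorff_content0 k d : hausdorff_content k d set0 = 0.
Proof.
apply/eqP; rewrite eq_le hausdorff_content_ge0 andbT.
apply: ereal_inf_lbound; exists (fun=> set0).
  by split=> [//|i x y []].
by rewrite eseries0 // => i _ _; rewrite hausdorff_weight0.
Qed.

Lemma le_hausdorff_content k d :
  {homo hausdorff_content k d : A B / A `<=` B >-> A <= B}.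
Proof.
move=> A B AB; apply: ereal_inf_le_tmp => _ [F [BF dF] <-].
by exists F => //; split => //; apply: subset_trans AB BF.
Qed.

Lemma hausdorff_content_sigma_subadditive k d :
  sigma_subadditive (hausdorff_content k d).
Proof.
move=> A; have [[i ioo]|] := pselect (exists i, hausdorff_content k d (A i) = +oo).
  rewrite (eseries_pinfty _ _ ioo) ?leey// => j _.
  by rewrite -ltNye (lt_le_trans _ (hausdorff_content_ge0 _ _ _)).
rewrite -forallNE => Aoo.
suff add2e (e : {posnum R}) : hausdorff_content k d (\bigcup_n A n) <=
    \sum_(i <oo) hausdorff_content k d (A i) + e%:num%:E.
  by apply/lee_addgt0Pr => _/posnumP[].
rewrite (le_trans _ (epsilon_trick _ _ _))//; last first.
  by move=> j; exact: hausdorff_content_ge0.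
pose w B := (hausdorff_weight k B)%:E.
have w0 B : 0 <= w B by rewrite lee_fin hausdorff_weight_ge0.
pose P j (F : (set 'rV[R]_n)^nat) := hausdorff_cover d (A j) F /\
  \sum_(i <oo) w (F i) <=
  hausdorff_content k d (A j) + (e%:num / (2 ^ j.+1)%:R)%:E.
have [G PG] : {G : ((set 'rV[R]_n)^nat)^nat & forall j, P j (G j)}.
  apply: (@choice _ _ P) => j; rewrite /P /hausdorff_content.
  set S := (X in ereal_inf X); move infS : (ereal_inf S) => iS.
  case: iS infS => [r Sr|Soo|Soo].
  - have en1 : (0 < e%:num / (2 ^ j.+1)%:R)%R by [].
    have /(lb_ereal_inf_adherent en1) : ereal_inf S \is a fin_num by rewrite Sr.
    move=> [x [B cB muBx] xS].
    by exists B; split => //; rewrite muBx -Sr; exact/ltW.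
  - by have := Aoo j; rewrite /hausdorff_content Soo.
  - suff : lbound S 0 by move/le_ereal_inf_tmp; rewrite Soo.
    by move=> /= _ [B _ <-]; apply: nneseries_ge0 => *; exact: w0.
have wG_ge0 x : 0 <= (w \o uncurry G) x by exact: w0.
apply: (@le_trans _ _ (\esum_(i in setT) (w \o uncurry G) i)).
  apply: ereal_inf_lbound => /=.
  have /card_esym/ppcard_eqP[f] := card_nat2.
  exists (uncurry G \o f).
    split => [t [i _ Ait]|i]; last first.
      by rewrite /comp; case: (f i) => a b; exact: ((PG a).1.2 b).
    have [j _ Gijt] := (PG i).1.1 t Ait.
    by exists (f^-1%FUN (i, j)) => //=; rewrite invK ?inE.
  rewrite -(esum_pred_image (w \o uncurry G) _ xpredT) ?[fun=> _]set_true//.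
  by rewrite image_eq.
rewrite (_ : esum _ _ = \sum_(i <oo) \sum_(j <oo ) w (G i j)); last first.
  pose J : nat -> set (nat * nat) := fun i => [set (i, j) | j in setT].
  rewrite (_ : setT = \bigcup_k J k); last first.
    by rewrite predeqE => -[a b]; split => // _; exists a => //; exists b.
  rewrite esum_bigcupT /=; last 2 first.
    - apply/trivIsetP => i j _ _ ij.
      rewrite predeqE => -[a b] /=; split => //= -[] [_] _ [<-{a} _].
      by move=> [m' _] [] /esym/eqP; rewrite (negbTE ij).
    - by move=> /= [a b]; exact: w0.
  rewrite -(image_id [set: nat]) -fun_true esum_pred_image//; last first.
    by move=> a _; exact: esum_ge0.
  apply: eq_eseriesr => /= j _.
  rewrite -(esum_pred_image (w \o uncurry G) (pair j) predT)//=; last first.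
    by move=> ? ? _ _; exact: (@can_inj _ _ _ snd).
  by congr esum; rewrite predeqE => -[a b]; split; move=> [i _ <-]; exists i.
apply: lee_lim.
- apply: is_cvg_nneseries => i *.
  by apply: nneseries_ge0 => j *; exact: (wG_ge0 (i, j)).
- apply: is_cvg_nneseries => i *; apply: adde_ge0 => //.
  exact: hausdorff_content_ge0.
- by near=> i; apply: lee_sum => j _; exact: (PG j).2.
Unshelve. all: by end_near. Qed.

Lemma hausdorff_ge0 k A : 0 <= hausdorff k A.
Proof.
apply: (le_trans (hausdorff_content_ge0 k 1 A)); apply: ereal_sup_ubound.
by exists 1%R => //=.
Qed.

Lemma hausdorff0 k : hausdorff k set0 = 0.
Proof.
apply/eqP; rewrite eq_le hausdorff_ge0 andbT; apply: ge_ereal_sup => _ [d _ <-].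
by rewrite hausdorff_content0.
Qed.

Lemma le_hausdorff k : {homo hausdorff k : A B / A `<=` B >-> A <= B}.
Proof.
move=> A B AB; apply: ge_ereal_sup => _ [d d0 <-].
apply: (le_trans (le_hausdorff_content k d AB)).
by apply: ereal_sup_ubound; exists d.
Qed.

Lemma hausdorff_sigma_subadditive k : sigma_subadditive (hausdorff k).
Proof.
move=> F; apply: ge_ereal_sup => _ [d d0 <-].
apply: (le_trans (hausdorff_content_sigma_subadditive k d F)).
apply: lee_nneseries => [i *|i *]; first exact: hausdorff_content_ge0.
by apply: ereal_sup_ubound; exists d.
Qed.

HB.instance Definition _ k := isOuterMeasure.Build R 'rV[R]_n (hausdorff k)
  (hausdorff0 k) (hausdorff_ge0 k) (@le_hausdorff k)
  (@hausdorff_sigma_subadditive k).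

End hausdorff.

(* The (n-1)-dimensional surface measure of R^n, on the Caratheodory
   sigma-algebra of the Hausdorff outer measure. *)
Definition surface_outer_measure (R : realType) (n : nat) :
    {outer_measure set 'rV[R]_n -> \bar R} :=
  @hausdorff R n n.-1.

Definition surface_measure (R : realType) (n : nat) :
    {measure set (caratheodory_type (surface_outer_measure R n)) -> \bar R} :=
  (surface_outer_measure R n :
     set (caratheodory_type (surface_outer_measure R n)) -> \bar R).

Definition surface_integral (R : realType) (n : nat) (S : set 'rV[R]_n)
    (f : 'rV[R]_n -> R) : \bar R :=
  (\int[surface_measure R n]_(x in S) (f x)%:E)%E.

Definition area (R : realType) (n : nat) (S : set 'rV[R]_n) : R :=
  fine (surface_measure R n S).

Definition partial (R : realType) (n : nat) (i : 'I_n) (f : 'rV[R]_n -> R) :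
    'rV[R]_n -> R :=
  fun x => 'D_(delta_mx 0 i) f x.

Definition grad (R : realType) (n : nat) (f : 'rV[R]_n -> R) (x : 'rV[R]_n) :
    'rV[R]_n :=
  \row_i partial i f x.

Definition divergence (R : realType) (n : nat) (v : 'rV[R]_n -> 'rV[R]_n)
    (x : 'rV[R]_n) : R :=
  \sum_(i < n) partial i (fun y => v y 0 i) x.

(* [Ck k U f]: f is of class C^k on the open set U. *)
Fixpoint Ck (R : realType) (n k : nat) (U : set 'rV[R]_n) (f : 'rV[R]_n -> R) :
    Prop :=
  match k with
  | 0 => forall x, U x -> {for x, continuous f}
  | k'.+1 => (forall x, U x -> differentiable f x) /\
             forall i : 'I_n, Ck k' U (partial i f)
  end.

Definition C2alpha (R : realType) (n : nat) (alpha : R) (U : set 'rV[R]_n)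
    (f : 'rV[R]_n -> R) : Prop :=
  Ck 2 U f /\
  exists C : R, forall (i j : 'I_n) x y, U x -> U y ->
    `|partial j (partial i f) x - partial j (partial i f) y|
      <= C * enorm (x - y) `^ alpha.

(* C^1 on the open set U, with f and its first derivatives extending
   continuously to K; K is meant to consist of U and boundary points of U. *)
Definition C1_up_to (R : realType) (n : nat) (U K : set 'rV[R]_n)
    (f : 'rV[R]_n -> R) : Prop :=
  [/\ Ck 1 U f, {within K, continuous f} &
      forall i : 'I_n, exists2 g : 'rV[R]_n -> R,
        {within K, continuous g} & forall x, U x -> g x = partial i f x].

(* Near x, Omega = {g < 0} with g regular at x; this makes x a boundary point
   of Omega, and the gradient of g points out of Omega. *)
Definition local_defining_function (R : realType) (n : nat)
    (Omega : set 'rV[R]_n) (x : 'rV[R]_n) (V : set 'rV[R]_n)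
    (g : 'rV[R]_n -> R) : Prop :=
  [/\ open V, V x, g x = 0, grad g x != 0 &
      forall y, V y -> (Omega y <-> g y < 0)].

Definition boundary (R : realType) (n : nat) (A : set 'rV[R]_n) :
    set 'rV[R]_n :=
  closure A `\` interior A.

Definition C2alpha_boundary (R : realType) (n : nat) (alpha : R)
    (Omega : set 'rV[R]_n) : Prop :=
  forall x, boundary Omega x ->
    exists V g, local_defining_function Omega x V g /\ C2alpha alpha V g.

Definition outward_normal (R : realType) (n : nat) (Omega : set 'rV[R]_n)
    (x nu : 'rV[R]_n) : Prop :=
  exists V g, [/\ local_defining_function Omega x V g, Ck 1 V g &
                  nu = (enorm (grad g x))^-1 *: grad g x].

(* Connected, relatively open part of the unit sphere whose relative boundary
   is smooth: near each relative boundary point it is {g < 0} on the sphere,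
   where the tangential part of the gradient of g does not vanish. *)
Record smooth_spherical_part (R : realType) (n : nat) (Sigma : set 'rV[R]_n) :
    Prop := {
  ssp_nonempty : Sigma !=set0 ;
  ssp_open : exists2 U, open U & Sigma = U `&` esphere 0 1 ;
  ssp_connected : connected Sigma ;
  ssp_smooth : forall w, (closure Sigma `\` Sigma) w ->
    exists V g, [/\ open V, V w, forall k, Ck k V g &
      [/\ g w = 0, grad g w - dotv (grad g w) w *: w != 0 &
          forall x, V x -> esphere 0 1 x -> (Sigma x <-> g x < 0)]] }.

Definition truncated_cone (R : realType) (n : nat) (A : 'rV[R]_n)
    (Sigma : set 'rV[R]_n) (r0 : R) : set 'rV[R]_n :=
  [set x | exists w r, [/\ Sigma w, r0 < r & x = A + r *: w]].

Record nozzle (R : realType) (n : nat) := Nozzle {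
  domain : set 'rV[R]_n ;
  throat : set 'rV[R]_n ;
  vertexP : 'rV[R]_n ; SigmaP : set 'rV[R]_n ; radiusP : R ;
  vertexM : 'rV[R]_n ; SigmaM : set 'rV[R]_n ; radiusM : R }.

Definition divergent_part (R : realType) (n : nat) (N : nozzle R n) :=
  truncated_cone (vertexP N) (SigmaP N) (radiusP N).

Definition convergent_part (R : realType) (n : nat) (N : nozzle R n) :=
  truncated_cone (vertexM N) (SigmaM N) (radiusM N).

Record is_nozzle (R : realType) (n : nat) (alpha : R) (N : nozzle R n) :
    Prop := {
  nozzle_radiusP : 0 < radiusP N ;
  nozzle_radiusM : 0 < radiusM N ;
  nozzle_SigmaP : smooth_spherical_part (SigmaP N) ;
  nozzle_SigmaM : smooth_spherical_part (SigmaM N) ;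
  nozzle_open : open (domain N) ;
  nozzle_connected : connected (domain N) ;
  nozzle_decomposition :
    domain N = divergent_part N `|` throat N `|` convergent_part N ;
  nozzle_disjoint : divergent_part N `&` convergent_part N = set0 ;
  nozzle_throat : bounded_set (throat N) ;
  nozzle_boundary : C2alpha_boundary alpha (domain N) }.

(* S is a connected hypersurface of finite area in the nozzle, separating its
   convergent end (contained in Um) from its divergent end (contained in Up);
   S is locally the zero set of a regular C^1 function g, with Up = {g > 0} and
   Um = {g < 0}, so that the unit normal l = grad g / |grad g| on S points
   downstream. *)
Definition cross_section (R : realType) (n : nat) (N : nozzle R n)
    (S : set 'rV[R]_n) (l : 'rV[R]_n -> 'rV[R]_n) : Prop :=
  [/\ connected S, (surface_measure R n S < +oo)%E &
  exists Um Up : set 'rV[R]_n,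
    [/\ open Um, open Up, Um `&` Up = set0, domain N `\` S = Um `|` Up &
    [/\ S `<=` domain N,
        exists r : R, forall x, convergent_part N x -> r < enorm x -> Um x,
        exists r : R, forall x, divergent_part N x -> r < enorm x -> Up x &
        forall x, S x -> exists V g,
          [/\ open V, V x, V `<=` domain N, Ck 1 V g &
          [/\ grad g x != 0,
              l x = (enorm (grad g x))^-1 *: grad g x &
              forall y, V y -> [/\ S y <-> g y = 0, Up y <-> 0 < g y &
                                   Um y <-> g y < 0]]]]]].

Record pressure_law (R : realType) (p : R -> R) : Prop := {
  pressure_continuous : {within `[0, +oo[, continuous p} ;
  pressure_C2 : forall s : R, 0 < s ->
    [/\ derivable p s 1, derivable (derive1 p) s 1 &
        {for s, continuous (derive1 (derive1 p))}] ;
  pressure_incr : forall s : R, 0 < s -> 0 < derive1 p s ;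
  pressure_convex : forall s : R, 0 < s ->
    0 < 2 * derive1 p s + s * derive1 (derive1 p) s }.

Definition enthalpy (R : realType) (p h : R -> R) : Prop :=
  forall s : R, 0 < s -> is_derive s 1 h (derive1 p s / s).

Definition sound_speed (R : realType) (p : R -> R) (s : R) : R :=
  Num.sqrt (derive1 p s).

Definition bernoulli (R : realType) (h : R -> R) (B q s : R) : Prop :=
  q ^+ 2 / 2 + h s = B.

(* The equivalence |u| < qcr <-> |u| < c(rho) is meant for the speeds q and
   densities s related by the Bernoulli law. *)
Definition critical_speed (R : realType) (p h : R -> R) (B qcr : R) : Prop :=
  forall q s : R, 0 <= q -> 0 < s -> bernoulli h B q s ->
    (q < qcr <-> q < sound_speed p s).

Definition far_region (R : realType) (n : nat) (N : nozzle R n) (R1 : R) :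
    set 'rV[R]_n :=
  domain N `&` [set x | R1 <= enorm x].

(* Bernoulli's law, with h strictly increasing, makes rho a function of
   |u|^2; rho is carried along as a function of the position. The equations at
   points with |x| = R1 follow from those with R1 < |x| by continuity. *)
Record largely_open_flow (R : realType) (n : nat) (h : R -> R) (B : R)
    (N : nozzle R n) (R1 m : R) (u : 'rV[R]_n -> 'rV[R]_n)
    (rho : 'rV[R]_n -> R) : Prop := {
  flow_R1 : 0 < R1 ;
  flow_R1_large : forall x, throat N x -> enorm x < R1 ;
  flow_u_regular : forall i : 'I_n,
    C1_up_to (domain N `&` [set x | R1 < enorm x])
             (closure (domain N) `&` [set x | R1 <= enorm x])
             (fun x => u x 0 i) ;
  flow_rho_regular :
    C1_up_to (domain N `&` [set x | R1 < enorm x])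
             (closure (domain N) `&` [set x | R1 <= enorm x]) rho ;
  flow_rho_gt0 : forall x, far_region N R1 x -> 0 < rho x ;
  flow_mass : forall x, domain N x -> R1 < enorm x ->
    divergence (fun y => rho y *: u y) x = 0 ;
  flow_curl : forall x, domain N x -> R1 < enorm x -> forall i j : 'I_n,
    partial i (fun y => u y 0 j) x = partial j (fun y => u y 0 i) x ;
  flow_bernoulli : forall x, far_region N R1 x ->
    bernoulli h B (enorm (u x)) (rho x) ;
  flow_slip : forall x nu, boundary (domain N) x -> R1 <= enorm x ->
    outward_normal (domain N) x nu -> dotv (u x) nu = 0 ;
  flow_flux : forall S l, cross_section N S l -> S `<=` far_region N R1 ->
    surface_integral S (fun x => dotv (rho x *: u x) (l x)) = m%:E }.

Definition subsonic (R : realType) (n : nat) (qcr : R) (D : set 'rV[R]_n)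
    (u : 'rV[R]_n -> 'rV[R]_n) : Prop :=
  (ereal_sup [set (enorm (u x))%:E | x in D] < qcr%:E)%E.

Definition spherical_section (R : realType) (n : nat) (N : nozzle R n) (r : R) :
    set 'rV[R]_n :=
  divergent_part N `&` esphere (vertexP N) r.

Definition state_at_infinity (R : realType) (n : nat) : 'rV[R]_n := 0.

(* Main.v *)
Require Import Defs.
From mathcomp Require Import all_boot all_order all_algebra.
From mathcomp Require Import all_classical all_reals all_analysis.
From mathcomp Require Import ring lra.
Import Order.TTheory GRing.Theory Num.Theory.
Import numFieldNormedType.Exports.
Local Open Scope classical_set_scope.
Local Open Scope ring_scope.

Set Implicit Arguments.
Unset Strict Implicit.
Unset Printing Implicit Defensive.

(** Write A for the vertex of the divergent cone and S_r for its spherical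
    section of radius r. For large r the section S_r separates the two ends of
    the nozzle, so it is a cross-section in the sense of the flux condition
    ([cross_section_spherical_section]) and the mass flux through it is m. Since
    S_r = A + r Sigma, scaling of the Hausdorff measure gives
    |S_r| <= r^(n-1) |Sigma| ([surface_spherical_section_le]). The flux density
    rho u . l is at most Lambda |u| ([flux_density_le]). If Lambda |u| were
    smaller than c = (m / |Sigma|) r^(1-n) all over S_r, the flux would be
    smaller than c |S_r| <= m, a contradiction ([exists_speed_ge]).

    Two points need care. First, the area of S_r has to be finite and nonzero.
    Finiteness comes from covering the unit sphere of R^(k+1) by O(N^k) cells of
    diameter O(1/N) ([hausdorff_sphere_lty]); nonvanishing comes from the flux
    itself, as an integral over a null set cannot equal m > 0
    ([surface_spherical_section_gt0], [area_SigmaP_gt0]). Secondly, the strict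
    inequality between the integral and c |S_r| is proved for an arbitrary set
    and an arbitrary integrand ([integral_outer_measure_lt]), so the
    measurability of S_r and of u for the Caratheodory sigma-algebra of the
    Hausdorff measure is never needed.

    For the optimality of the decay rate, |x| >= r / 2 on S_r for large r, so a
    decay faster than |x|^(1-n) would contradict the lower bound
    ([not_faster_decay]). *)

(** * The Euclidean norm *)

Section euclidean.
Context (R : realType) (n : nat).
Implicit Types (x y z : 'rV[R]_n) (a : R).

Lemma dotvC x y : dotv x y = dotv y x.
Proof. by apply: eq_bigr => i _; rewrite mulrC. Qed.

Lemma dotvDl x y z : dotv (x + y) z = dotv x z + dotv y z.
Proof. by rewrite -big_split; apply: eq_bigr => i _ /=; rewrite mxE mulrDl. Qed.

Lemma dotvZl a x y : dotv (a *: x) y = a * dotv x y.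
Proof. by rewrite mulr_sumr; apply: eq_bigr => i _; rewrite mxE mulrA. Qed.

Lemma dotvDr x y z : dotv x (y + z) = dotv x y + dotv x z.
Proof. by rewrite dotvC dotvDl !(dotvC x). Qed.

Lemma dotvZr a x y : dotv x (a *: y) = a * dotv x y.
Proof. by rewrite dotvC dotvZl dotvC. Qed.

Lemma dotv_eq0 x : (dotv x x == 0) = (x == 0).
Proof.
apply/idP/eqP => [|->]; last first.
  by rewrite /dotv big1 // => i _; rewrite mxE mul0r.
rewrite psumr_eq0 => [/allP h|i _]; last by rewrite -expr2 sqr_ge0.
apply/rowP => i; rewrite mxE; apply/eqP.
by have := h i (mem_index_enum i); rewrite /= -expr2 sqrf_eq0.
Qed.

Lemma enorm_ge0 x : 0 <= enorm x.
Proof. exact: sqrtr_ge0. Qed.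

Lemma sqr_enorm x : enorm x ^+ 2 = dotv x x.
Proof. by rewrite sqr_sqrtr // dotv_ge0. Qed.

Lemma enorm_eq0 x : (enorm x == 0) = (x == 0).
Proof. by rewrite -sqrf_eq0 sqr_enorm dotv_eq0. Qed.

Lemma enormZ a x : enorm (a *: x) = `|a| * enorm x.
Proof.
by rewrite /enorm dotvZl dotvZr mulrA -expr2 sqrtrM ?sqr_ge0 // sqrtr_sqr.
Qed.

Lemma enormN x : enorm (- x) = enorm x.
Proof. by rewrite -scaleN1r enormZ normrN1 mul1r. Qed.

(** Cauchy-Schwarz inequality, from 0 <= |(y.y) x - (x.y) y|^2 *)
Lemma dotv_le_enorm x y : dotv x y <= enorm x * enorm y.
Proof.
have [->|y0] := eqVneq y 0.
  by rewrite /dotv big1 ?mulr_ge0 ?enorm_ge0 // => i _; rewrite mxE mulr0.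
have yy : 0 < dotv y y by rewrite lt_def dotv_eq0 y0 dotv_ge0.
apply: (le_trans (ler_norm _)).
rewrite -(@ler_pXn2r _ 2) ?nnegrE ?mulr_ge0 ?enorm_ge0 //.
rewrite exprMn !sqr_enorm real_normK ?num_real // -(ler_pM2l yy).
have := dotv_ge0 (dotv y y *: x + (- dotv x y) *: y).
rewrite !(dotvDl, dotvDr, dotvZl, dotvZr) (dotvC y x); nra.
Qed.

Lemma enormD x y : enorm (x + y) <= enorm x + enorm y.
Proof.
rewrite -(@ler_pXn2r _ 2) ?nnegrE ?addr_ge0 ?enorm_ge0 //.
rewrite sqrrD !sqr_enorm !(dotvDl, dotvDr) (dotvC y x).
have := dotv_le_enorm x y; lra.
Qed.

Lemma dotv_continuous : continuous (fun x : 'rV[R]_n => dotv x x).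
Proof.
apply: (@continuous_big R^o _ +%R 0 xpredT) => [|i _ x]; first exact: add_continuous.
by apply: continuousM; exact: coord_continuous.
Qed.

Lemma enorm_continuous : continuous (@enorm R n).
Proof.
move=> x; apply: (@continuous_comp _ _ _ (fun x : 'rV[R]_n => dotv x x)).
  exact: dotv_continuous.
exact: sqrt_continuous.
Qed.

Lemma enorm_coord x i : `|x 0 i| <= enorm x.
Proof.
rewrite -(@ler_pXn2r _ 2) ?nnegrE ?enorm_ge0 // sqr_enorm real_normK ?num_real //.
rewrite /dotv (bigD1 i) //= -expr2 lerDl sumr_ge0 // => j _.
by rewrite -expr2 sqr_ge0.
Qed.

Lemma enorm_le_sum x : enorm x <= \sum_(i < n) `|x 0 i|.
Proof.
rewrite -(@ler_pXn2r _ 2) ?nnegrE ?enorm_ge0 ?sumr_ge0 // sqr_enorm expr2.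
rewrite mulr_suml; apply: ler_sum => i _.
rewrite (le_trans (ler_norm _)) // normrM ler_wpM2l //.
by rewrite (bigD1 i) //= lerDl sumr_ge0.
Qed.

End euclidean.

(** * Integrals against an outer measure

    The integral is defined through the simple functions below the integrand,
    for any integrand and any domain. Only these simple functions are measurable
    in what follows. *)

Section integral_outer_measure.
Context (R : realType) (T : pointedType) (mu : {outer_measure set T -> \bar R}).
Local Notation nu :=
  ((mu : set (caratheodory_type mu) -> \bar R) : {measure set _ -> \bar R}).
Local Open Scope ereal_scope.
Import HBNNSimple.

(** If f < c on a set of positive outer measure, then f <= c - e on a subset of
    positive outer measure for some e > 0, by countable subadditivity. *)
Lemma outer_measure_lt_gt0 (S : set T) (f : T -> R) (c : R) :
  (0 < c)%R -> (forall x, S x -> (f x < c)%R) -> 0 < mu S ->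
  exists e : R, [/\ (0 < e <= c)%R & 0 < mu [set x | S x /\ (f x <= c - e)%R]].
Proof.
move=> c0 fc muS; pose E k := [set x | S x /\ (f x <= c - k.+1%:R^-1)%R].
have SE : S `<=` \bigcup_k E k.
  move=> x Sx; have := fc x Sx; rewrite -subr_gt0 => /ltr_add_invr[k].
  by rewrite add0r => /ltW h; exists k => //; split; rewrite // lerBrDr -lerBrDl.
have [k Ek] : exists k, 0 < mu (E k).
  apply: contrapT => /forallNP h; move: muS; apply/negP; rewrite -leNgt.
  rewrite (le_trans (le_outer_measure mu _ _ SE)) //.
  rewrite (le_trans (outer_measure_sigma_subadditive mu E)) // eseries0 // => k _ _.
  by apply/eqP; rewrite eq_le outer_measure_ge0 leNgt andbT; exact/negP/h.
(* the minimum with c keeps c - e nonnegative *)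
exists (Num.min k.+1%:R^-1 c)%R; split.
  by rewrite lt_min c0 invr_gt0 ltr0Sn ge_min lexx orbT.
apply: (lt_le_trans Ek); apply: le_outer_measure => x [Sx fx]; split => //.
by rewrite (le_trans fx) // lerD2l lerN2 ge_min lexx.
Qed.

(** Bounding an integral amounts to bounding the integrals of the nonnegative
    simple functions h that lie below f and vanish outside of S. *)
Lemma integral_le_nnsfun (S : set T) (f : T -> R) (M : \bar R) :
  (forall h : {nnsfun caratheodory_type mu >-> R},
     (forall x, (0 < h x)%R -> S x /\ (h x <= f x)%R) -> sintegral nu h <= M) ->
  \int[nu]_(x in S) (f x)%:E <= M.
Proof.
move=> hM; rewrite integralE (@le_trans _ _ (\int[nu]_(x in S) ((EFin \o f)^\+ x))) //.
  by rewrite -[leRHS]sube0 leeB // integral_ge0.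
rewrite ge0_integralE //; apply: ge_ereal_sup => _ [h /= hf <-]; apply: hM => x.
have := hf x; rewrite /patch; case: ifPn => [xS|_ ]; last first.
  by rewrite lee_fin => h1 h2; have := le_lt_trans h1 h2; rewrite ltxx.
rewrite /= funeposE /= /maxe; case: ifPn => _; rewrite lee_fin => h1 h2.
  by have := le_lt_trans h1 h2; rewrite ltxx.
by split => //; exact: set_mem.
Qed.

Lemma integral_outer_measure0 (S : set T) (f : T -> R) :
  mu S = 0 -> \int[nu]_(x in S) (f x)%:E <= 0.
Proof.
move=> S0; apply: integral_le_nnsfun => h hS.
rewrite sintegralET fsbig1 // => y _; have [y0|y0] := ltP 0%R y; last first.
  have [->|hy] := eqVneq y 0%R; first by rewrite mul0e.
  rewrite preimage_nnfun0 ?measure0 ?mule0 //; lra.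
have yS : h @^-1` [set y] `<=` S by move=> x /= hx; have [] := hS x; rewrite ?hx.
rewrite [X in _ * X](_ : _ = 0) ?mule0 //.
by apply/eqP; rewrite eq_le outer_measure_ge0 andbT -S0; exact: le_outer_measure.
Qed.

(** Neither S nor f is assumed measurable. With E = {f <= c - e} of positive
    outer measure, every simple function h below f satisfies h <= c on
    A = {h > c - e} and h <= c - e elsewhere; A is measurable and does not meet
    E, which bounds the integral of h by c mu(S) - e mu(E). *)
Lemma integral_outer_measure_lt (S : set T) (f : T -> R) (c : R) :
  (0 < c)%R -> (forall x, S x -> (f x < c)%R) -> 0 < mu S < +oo ->
  \int[nu]_(x in S) (f x)%:E < c%:E * mu S.
Proof.
move=> c0 fc /andP[muS0 muSoo].
have [e [/andP[e0 ec] Ee]] := outer_measure_lt_gt0 c0 fc muS0.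
set E := [set x | _] in Ee.
have ce0 : (0 <= c - e)%R by rewrite subr_ge0.
have ES : E `<=` S by move=> x [].
have finS : mu S \is a fin_num by rewrite ge0_fin_numE ?ltW.
have finle A : A `<=` S -> mu A \is a fin_num.
  move=> AS; rewrite ge0_fin_numE ?outer_measure_ge0 //.
  exact: le_lt_trans (le_outer_measure mu _ _ AS) muSoo.
apply: (@le_lt_trans _ _ (c%:E * mu S - e%:E * mu E)); last first.
  by rewrite gte_subl ?fin_numM // mule_gt0.
apply: integral_le_nnsfun => h hS.
pose A := [set x | c - e < h x]%R; pose B := [set x | 0 < h x <= c - e]%R.
have mA : measurable A.
  rewrite (_ : A = h @^-1` `]c - e, +oo[)%R; last first.
    by apply/seteqP; split => x /=; rewrite in_itv /= andbT.
  by rewrite -[X in measurable X]setTI; exact: measurable_funP.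
have mB : measurable B.
  rewrite (_ : B = h @^-1` `]0, c - e])%R; last first.
    by apply/seteqP; split => x /=; rewrite in_itv.
  by rewrite -[X in measurable X]setTI; exact: measurable_funP.
pose g := add_nnsfun (scale_nnsfun (indic_nnsfun R mA) (ltW c0))
  (scale_nnsfun (indic_nnsfun R mB) ce0).
have hg x : (h x <= g x)%R.
  rewrite (_ : g x = c * \1_A x + (c - e) * \1_B x)%R // !indicE.
  have [hx0|hx0] := leP (h x) 0%R; last have [hce|hce] := leP (h x) (c - e)%R.
  - by rewrite (le_trans hx0) // addr_ge0 // mulr_ge0 ?subr_ge0 // ltW.
  - rewrite (mem_set (_ : B x)) /B /= ?hx0 ?hce // mulr1.
    by rewrite (le_trans hce) // lerDr mulr_ge0 // ltW.
  - rewrite (mem_set (_ : A x)) // mulr1.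
    have [Sx hfx] := hS x hx0; rewrite (le_trans hfx) // (le_trans (ltW (fc x Sx))) //.
    by rewrite lerDl mulr_ge0 // subr_ge0.
rewrite (le_trans (le_sintegral _ hg)) // sintegralD !sintegralrM !sintegral_indic.
change (c%:E * mu A + (c - e)%:E * mu B <= c%:E * mu S - e%:E * mu E).
have AS : A `<=` S.
  by move=> x Ax; have [] := hS x (le_lt_trans ce0 Ax).
have BSA : B `<=` S `&` ~` A.
  move=> x /andP[hx hce]; split; first by have [] := hS x hx.
  by apply/negP; rewrite -leNgt.
have ESA : E `<=` S `&` ~` A.
  move=> x [Sx fx]; split => // Ax.
  have [_] := hS x (le_lt_trans ce0 Ax).
  by move=> /le_trans/(_ fx); apply/negP; rewrite -ltNge.
(* Caratheodory measurability of A splits the outer measure of S *)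
have muSA : mu S = mu A + mu (S `&` ~` A).
  by rewrite (mA S) (_ : S `&` A = A) //; apply/setIidPr.
have fw : mu (S `&` ~` A) \is a fin_num by apply: finle => x [].
move: (le_outer_measure mu _ _ BSA) (le_outer_measure mu _ _ ESA) muSA.
rewrite -(fineK (finle _ ES)) -(fineK fw) -(fineK finS) -(fineK (finle _ AS)).
rewrite -(fineK (finle _ (subset_trans BSA _))); last by move=> x [].
rewrite !lee_fin -EFinD => bw ew [->].
have := ler_wpM2l ce0 bw.
have := ler_wpM2l (ltW e0) ew; lra.
Qed.

End integral_outer_measure.

(** * Hausdorff measure of Lipschitz images and of the sphere *)

Section diameter.
Context (R : realType) (n : nat).

Lemma le_diam (d : R) (A : set 'rV[R]_n) (x y : 'rV[R]_n) :
  diam_le d A -> A x -> A y -> enorm (x - y) <= diam A.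
Proof.
move=> dA Ax Ay; apply: ub_le_sup; last by exists x, y.
by exists d => _ [a [b [Aa Ab ->]]]; exact: dA.
Qed.

Lemma diam_le_diam (d : R) (A : set 'rV[R]_n) :
  A !=set0 -> diam_le d A -> diam A <= d.
Proof.
move=> [a Aa] dA; apply: ge_sup; first by exists (enorm (a - a)), a, a.
by move=> _ [x [y [Ax Ay ->]]]; exact: dA.
Qed.

Lemma hausdorff_weight_le (k : nat) (d : R) (A : set 'rV[R]_n) :
  0 <= d -> diam_le d A -> hausdorff_weight k A <= unit_ball_volume R k * (d / 2) ^+ k.
Proof.
move=> d0 dA; rewrite /hausdorff_weight; case: asboolP => [_|/eqP/set0P A0].
  by rewrite mulr_ge0 ?unit_ball_volume_ge0 ?exprn_ge0 ?divr_ge0.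
rewrite ler_wpM2l ?unit_ball_volume_ge0 // lerXn2r ?nnegrE ?divr_ge0 ?diam_ge0 //.
by rewrite ler_wpM2r // diam_le_diam.
Qed.

End diameter.

Lemma hausdorff_lipschitz (R : realType) (m n k : nat) (L : R)
    (f : 'rV[R]_m -> 'rV[R]_n) (A : set 'rV[R]_m) : 0 < L ->
  (forall x y, enorm (f x - f y) <= L * enorm (x - y)) ->
  (hausdorff k (f @` A) <= (L ^+ k)%:E * hausdorff k A)%E.
Proof.
move=> L0 fL; apply: ge_ereal_sup => _ [d /= d0 <-].
have Lk0 : 0 < L ^+ k by rewrite exprn_gt0.
apply: (@le_trans _ _ ((L ^+ k)%:E * hausdorff_content k (d / L) A)%E); last first.
  rewrite lee_pmul2l ?lte_fin //; apply: ereal_sup_ubound.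
  by exists (d / L) => //=; rewrite divr_gt0.
rewrite -ereal_inf_pZl //; apply: le_ereal_inf_tmp => _ [_ [F [AF dF] <-] <-].
have fdF i : diam_le d (f @` F i).
  move=> _ _ [x Fx <-] [y Fy <-]; rewrite (le_trans (fL x y)) //.
  by rewrite mulrC -ler_pdivlMr // (dF i).
apply: ge_ereal_inf; exists (\sum_(i <oo) (hausdorff_weight k (f @` F i))%:E)%E.
  exists (fun i => f @` F i) => //; split => // _ [x /AF[i _ Fx] <-].
  by exists i => //; exists x.
rewrite -nneseriesZl => [|i _]; last by rewrite lee_fin hausdorff_weight_ge0.
apply: lee_nneseries => i _; rewrite lee_fin ?hausdorff_weight_ge0 //.
rewrite /hausdorff_weight; case: asboolP => [_|/eqP/set0P fF0].
  by rewrite mulr_ge0 ?hausdorff_weight_ge0 ?exprn_ge0 ?(ltW L0).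
(* image and set are empty together, so both weights use the diameter formula *)
case: asboolP fF0 => [->|_ fF0]; first by rewrite image_set0 => /set0P; rewrite eqxx.
rewrite mulrCA ler_wpM2l ?unit_ball_volume_ge0 // -exprMn.
rewrite lerXn2r ?nnegrE ?mulr_ge0 ?divr_ge0 ?diam_ge0 ?(ltW L0) //.
rewrite mulrA ler_wpM2r // diam_le_diam // => _ _ [x Fx <-] [y Fy <-].
by rewrite (le_trans (fL x y)) // ler_wpM2l ?(ltW L0) // (le_diam (dF i)).
Qed.

Lemma hausdorff_content_finite_cover (R : realType) (n k : nat) (I : finType)
    (F : I -> set 'rV[R]_n) (A : set 'rV[R]_n) (e d : R) :
  0 <= e <= d -> A `<=` \bigcup_i F i -> (forall i, diam_le e (F i)) ->
  (hausdorff_content k d A <= (#|I|%:R * (unit_ball_volume R k * (e / 2) ^+ k))%:E)%E.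
Proof.
move=> /andP[e0 ed] AF Fe; pose G := nth set0 [seq F i | i <- enum I].
have sG : size [seq F i | i <- enum I] = #|I| by rewrite size_map -cardE.
have Ge j : diam_le e (G j).
  have [jI|jI] := ltnP j #|I|; last first.
    by rewrite /G nth_default ?sG // => x y [].
  have : G j \in [seq F i | i <- enum I].
    by rewrite mem_nth // sG.
  by case/mapP => i _ ->; exact: Fe.
apply: ge_ereal_inf; exists (\sum_(j <oo) (hausdorff_weight k (G j))%:E)%E.
  exists G => //; split => [x /AF[i _ Fx]|j x y Gx Gy]; last first.
    by rewrite (le_trans (Ge j x y Gx Gy)).
  exists (index i (enum I)) => //.
  by rewrite /G (nth_map i) ?index_mem ?mem_enum // nth_index // mem_enum.
rewrite (nneseries_split 0 #|I|) => [|j _]; last by rewrite lee_fin hausdorff_weight_ge0.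
rewrite add0n [X in (_ + X)%E]eseries0 ?adde0 => [|j jI _]; last first.
  by rewrite /G nth_default ?hausdorff_weight0 // sG.
rewrite sumEFin lee_fin -[in leRHS](subn0 #|I|) mulr_natl -sumr_const_nat.
by apply: ler_sum => j _; exact: hausdorff_weight_le.
Qed.

Section sphere.
Context (R : realType) (k : nat).

(** Cell (i, s, g) of the unit sphere: the coordinate i has the largest modulus,
    s tells whether it is nonnegative, and g gives, in the grid of step 1/N on
    [-1, 1], the positions of the k other coordinates. Since coordinate i is
    determined by s and the others, it is not subdivided, whence a number of cells
    proportional to N^k. *)
Definition sphere_cell (N : nat)
    (p : 'I_k.+1 * bool * {ffun 'I_k -> 'I_(2 * N).+1}) : set 'rV[R]_k.+1 :=
  [set x | [/\ esphere 0 1 x, forall j, `|x 0 j| <= `|x 0 p.1.1|,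
     (0 <= x 0 p.1.1) = p.1.2 &
     forall j, (p.2 j)%:R <= (x 0 (lift p.1.1 j) + 1) * N%:R < (p.2 j).+1%:R]].

Lemma sphere_cellP N : (0 < N)%N -> esphere 0 1 `<=` \bigcup_p sphere_cell (N := N) p.
Proof.
move=> N0 x Sx; have [i _ xi] := @arg_maxP _ _ _ ord0 xpredT (fun j => `|x 0 j|) isT.
have x1 j : 0 <= x 0 j + 1 <= 2.
  have := enorm_coord x j; have := Sx; rewrite /esphere /= subr0 => ->.
  rewrite ler_norml; lra.
have xN j : 0 <= (x 0 j + 1) * N%:R by rewrite mulr_ge0 //; case/andP: (x1 j).
have xN2 j : (Num.truncn ((x 0 j + 1) * N%:R)%R < (2 * N).+1)%N.
  rewrite ltnS -(@ler_nat R) (le_trans (_ : _ <= (x 0 j + 1) * N%:R)) ?truncn_le //.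
  by rewrite natrM ler_wpM2r //; case/andP: (x1 j).
exists (i, 0 <= x 0 i, [ffun j => Ordinal (xN2 (lift i j))]) => //.
split => //= [j|j]; first exact: xi.
by rewrite ffunE /=; exact: truncn_itv.
Qed.

Lemma diam_sphere_cell N p :
  (0 < N)%N -> diam_le (2 * k%:R / N%:R) (sphere_cell (N := N) p).
Proof.
case: p => [[i s] g] N0 x y [/= Sx xi xs xg] [/= Sy yi ys yg].
have N0' : 0 < N%:R :> R by rewrite ltr0n.
have xyj j : `|x 0 (lift i j) - y 0 (lift i j)| <= N%:R^-1.
  have /andP[gx xg'] := xg j; have /andP[gy yg'] := yg j.
  rewrite -[leRHS]mul1r ler_pdivlMr // -[N%:R in leLHS]gtr0_norm // -normrM mulrBl.
  by move: xg' yg'; rewrite -natr1 ler_norml; lra.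
(* |x_i - y_i| |x_i + y_i| is at most the sum over j of
   |x_j - y_j| |x_j + y_j|, where |x_j + y_j| <= |x_i| + |y_i| = |x_i + y_i| *)
have xyi : `|x 0 i - y 0 i| <= k%:R / N%:R.
  have [->|x0] := eqVneq (x 0 i - y 0 i) 0; first by rewrite normr0 divr_ge0.
  have xy : `|x 0 i + y 0 i| = `|x 0 i| + `|y 0 i|.
    have [x0'|x0'] := leP 0 (x 0 i).
      have y0' : 0 <= y 0 i by rewrite ys -xs.
      by rewrite !ger0_norm ?addr_ge0.
    have y0' : y 0 i < 0 by rewrite ltNge ys -xs -ltNge.
    by rewrite !ltr0_norm ?opprD //; lra.
  have xy0 : 0 < `|x 0 i + y 0 i|.
    rewrite xy lt_def addr_ge0 // andbT paddr_eq0 // !normr_eq0.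
    by apply: contraNN x0 => /andP[/eqP -> /eqP ->]; rewrite subr0.
  have : dotv x x - dotv y y = 0.
    by rewrite -!sqr_enorm -(subr0 x) -(subr0 y) Sx Sy subrr.
  rewrite /dotv !(bigD1_ord i) //= opprD addrACA -sumrB => /eqP.
  rewrite addr_eq0 => /eqP xyE; rewrite -(ler_pM2r xy0) -normrM.
  rewrite (_ : (x 0 i - y 0 i) * _ = x 0 i * x 0 i - y 0 i * y 0 i); last by ring.
  rewrite xyE normrN (le_trans (ler_norm_sum _ _ _)) //.
  rewrite (_ : _ / _ * _ = \sum_(j < k) N%:R^-1 * `|x 0 i + y 0 i|); last first.
    by rewrite sumr_const card_ord -mulrA mulr_natl.
  apply: ler_sum => j _.
  rewrite (_ : _ - _ = (x 0 (lift i j) - y 0 (lift i j)) *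
                       (x 0 (lift i j) + y 0 (lift i j))); last by ring.
  rewrite normrM ler_pM // xy (le_trans (ler_normD _ _)) // lerD //.
rewrite (le_trans (enorm_le_sum _)) // (bigD1_ord i) //= !mxE mulr_natl mulr2n mulrDl.
apply: lerD; first exact: xyi.
rewrite -[leLHS](mulr1 _) mulr1 -[k in leRHS]card_ord mulr_natl -sumr_const.
by apply: ler_sum => j _; rewrite !mxE.
Qed.

Lemma hausdorff_sphere_lty :
  (hausdorff k (esphere 0 1 : set 'rV[R]_k.+1) < +oo)%E.
Proof.
pose w := unit_ball_volume R k; have w0 : 0 <= w := unit_ball_volume_ge0 R k.
(* the number of cells is (k+1) 2 (2N+1)^k, with (2N+1)/N <= 3 *)
pose C := (k.+1 * 2)%:R * (w * (3 * k%:R) ^+ k).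
apply: (@le_lt_trans _ _ C%:E); last exact: ltry.
apply: ge_ereal_sup => _ [d /= d0 <-].
pose N := (Num.truncn (2 * k%:R / d)).+1.
have N0 : 0 < N%:R :> R by rewrite ltr0n.
have Nd : 2 * k%:R / N%:R <= d.
  rewrite ler_pdivrMr // [d * _]mulrC -ler_pdivrMr // ltW //; exact: truncnS_gt.
have kN : 0 <= 2 * k%:R / N%:R :> R by rewrite divr_ge0 // mulr_ge0.
apply: (le_trans (hausdorff_content_finite_cover k _ (@sphere_cellP N isT)
   (fun p => diam_sphere_cell (p := p) isT))); first by rewrite kN.
rewrite lee_fin !card_prod card_bool card_ord card_ffun !card_ord -/w.
rewrite natrM -mulrA ler_wpM2l // mulrCA ler_wpM2l // natrX -exprMn.
rewrite lerXn2r ?nnegrE ?mulr_ge0 ?divr_ge0 //.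
rewrite [leLHS](_ : _ = (2 * N).+1%:R / N%:R * k%:R); last first.
  by field; rewrite gt_eqF.
rewrite ler_wpM2r // ler_pdivrMr // -natr1 natrM.
have : 1 <= N%:R :> R by rewrite ler1n.
lra.
Qed.

End sphere.

(** * The squared distance to a point *)

Section dist_sqr.
Context (R : realType) (n : nat) (A : 'rV[R]_n).

Let coord (j : 'I_n) (y : 'rV[R]_n) : R := (y - A) 0 j.

Let differentiable_coord (j : 'I_n) (x : 'rV[R]_n) : differentiable (coord j) x.
Proof.
rewrite (_ : coord j = (fun y => y 0 j) - cst (A 0 j)); last first.
  by apply/funext => y; rewrite /coord !mxE.
apply: differentiableB; last exact: differentiable_cst.
exact: (@differentiable_coord R 1 n x 0 j).
Qed.

Let is_derive_coord (j : 'I_n) (x v : 'rV[R]_n) : is_derive x v (coord j) (v 0 j).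
Proof.
apply: DeriveDef.
  exact: diff_derivable.
apply: cvg_lim => //.
apply: cvg_near_cst; near=> h.
have h0 : h != 0 by near: h; exact: nbhs_dnbhs_neq.
rewrite /coord /= !mxE /GRing.scale /=; field; exact: h0.
Unshelve. all: by end_near. Qed.

Lemma dist_sqr_funE :
  (fun y : 'rV[R]_n => dotv (y - A) (y - A)) = \sum_(j < n) coord j * coord j.
Proof. by apply/funext => y; rewrite fct_sumE. Qed.

Lemma partial_dist_sqr (r : R) (i : 'I_n) :
  partial i (fun y => dotv (y - A) (y - A) - r) = fun x => 2 * (x - A) 0 i.
Proof.
apply/funext => x; rewrite /partial.
rewrite (_ : (fun y => _) = (\sum_(j < n) coord j * coord j) - cst r); last first.
  by rewrite -dist_sqr_funE.
have h j : is_derive x (delta_mx 0 i) (coord j * coord j) (2 * coord j x * (i == j)%:R).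
  apply: (is_derive_eq (is_deriveM (is_derive_coord j x _) (is_derive_coord j x _))).
  rewrite mxE eqxx /= /GRing.scale /= eq_sym; ring.
rewrite (derive_val (is_derive := is_deriveB (is_derive_sum h) (is_derive_cst r x _))).
rewrite (bigD1 i) //= eqxx mulr1 big1 ?addr0 ?subr0 // => j /negbTE.
by rewrite eq_sym => ->; rewrite mulr0.
Qed.

Lemma grad_dist_sqr (r : R) (x : 'rV[R]_n) :
  grad (fun y => dotv (y - A) (y - A) - r) x = 2 *: (x - A).
Proof. by apply/rowP => i; rewrite [LHS]mxE partial_dist_sqr [RHS]mxE. Qed.

Lemma dist_sqr_C1 (r : R) (U : set 'rV[R]_n) :
  Ck 1 U (fun y => dotv (y - A) (y - A) - r).
Proof.
split => [x _|i x _]; last first.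
  rewrite partial_dist_sqr; apply: continuousM; first exact: cst_continuous.
  exact: differentiable_continuous (differentiable_coord i x).
rewrite (_ : (fun y => _) = (\sum_(j < n) coord j * coord j) - cst r); last first.
  by rewrite -dist_sqr_funE.
apply: differentiableB; last exact: differentiable_cst.
by apply: differentiable_sum => j; apply: differentiableM; exact: differentiable_coord.
Qed.

End dist_sqr.

(** * Truncated cones *)

Section cone.
Context (R : realType) (n : nat) (A : 'rV[R]_n) (Sigma : set 'rV[R]_n) (r0 : R).
Hypotheses (r0_ge0 : 0 <= r0) (Sigma_sphere : Sigma `<=` esphere 0 1).

Lemma Sigma_enorm w : Sigma w -> enorm w = 1.
Proof. by move=> /Sigma_sphere; rewrite /esphere /= subr0. Qed.

Lemma truncated_coneP x : truncated_cone A Sigma r0 x <->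
  r0 < enorm (x - A) /\ Sigma ((enorm (x - A))^-1 *: (x - A)).
Proof.
split=> [[w [r [Sw rr ->]]]|[rx Sx]]; last first.
  exists ((enorm (x - A))^-1 *: (x - A)), (enorm (x - A)); split => //.
  by rewrite scalerA divff ?scale1r ?subrKC // gt_eqF // (le_lt_trans r0_ge0).
have r_gt0 : 0 < r by exact: le_lt_trans rr.
rewrite [A + _]addrC addrK enormZ (Sigma_enorm Sw) mulr1 gtr0_norm //.
by rewrite scalerA mulVf ?scale1r // gt_eqF.
Qed.

Lemma truncated_cone_sphereE r : r0 < r ->
  truncated_cone A Sigma r0 `&` esphere A r = (fun w => A + r *: w) @` Sigma.
Proof.
move=> rr; have r_gt0 : 0 < r by exact: le_lt_trans rr.
apply/seteqP; split=> [x [/truncated_coneP[_ Sx] xr]|_ [w Sw <-]].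
  exists ((enorm (x - A))^-1 *: (x - A)) => //.
  by rewrite xr scalerA divff ?scale1r ?subrKC // gt_eqF.
split; first by exists w, r.
by rewrite /esphere /= [A + _]addrC addrK enormZ (Sigma_enorm Sw) mulr1 gtr0_norm.
Qed.

Lemma truncated_cone_open :
  (exists2 U, open U & Sigma = U `&` esphere 0 1) ->
  open (truncated_cone A Sigma r0).
Proof.
move=> [U oU SU].
pose d (x : 'rV[R]_n) := enorm (x - A).
have cB : continuous (fun x : 'rV[R]_n => x - A).
  by move=> x; apply: continuousB => //; exact: cst_continuous.
have cd : continuous d.
  by move=> x; apply: (continuous_comp (cB x)); exact: enorm_continuous.
rewrite openE => x /truncated_coneP[rx Sx].
have dx : d x != 0 by rewrite gt_eqF // (le_lt_trans r0_ge0).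
rewrite /interior; near=> y; apply/truncated_coneP.
have ry : r0 < enorm (y - A).
  by near: y; exact: (cd x [set t | r0 < t] (open_nbhs_nbhs (conj (@open_gt R r0) rx))).
split => //; rewrite SU; split; last first.
  rewrite /esphere /= subr0 enormZ gtr0_norm ?mulVf // ?gt_eqF // ?invr_gt0.
    exact: le_lt_trans ry.
  exact: le_lt_trans ry.
near: y.
have : {for x, continuous (fun y => (d y)^-1 *: (y - A))}.
  apply: continuousZ; last exact: cB.
  by apply: continuousV => //; exact: cd.
move=> /(_ U); apply; apply: open_nbhs_nbhs; split => //.
by move: Sx; rewrite SU => -[].
Unshelve. all: by end_near. Qed.

End cone.

(** * Spherical sections of a nozzle are cross-sections *)

Section spherical_section.
Context (R : realType) (n : nat) (alpha : R) (N : nozzle R n).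
Hypothesis nozzleN : is_nozzle alpha N.
Let A := vertexP N.

Lemma smooth_spherical_part_sphere (Sigma : set 'rV[R]_n) :
  smooth_spherical_part Sigma -> Sigma `<=` esphere 0 1.
Proof. by case=> _ [U _ ->] _ _ x []. Qed.

Lemma spherical_sectionE r : radiusP N < r ->
  spherical_section N r = (fun w => A + r *: w) @` SigmaP N.
Proof.
apply: truncated_cone_sphereE; first exact/ltW/(nozzle_radiusP nozzleN).
exact/smooth_spherical_part_sphere/(nozzle_SigmaP nozzleN).
Qed.

Lemma connected_spherical_section r : radiusP N < r ->
  connected (spherical_section N r).
Proof.
move=> rr; rewrite spherical_sectionE //; apply: connected_continuous_connected.
  exact: ssp_connected (nozzle_SigmaP nozzleN).
apply: continuous_subspaceT => w; apply: continuousD; first exact: cst_continuous.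
by apply: continuousZ => //; exact: cst_continuous.
Qed.

Lemma surface_SigmaP_lty : (0 < n)%N -> (surface_outer_measure R n (SigmaP N) < +oo)%E.
Proof.
move=> n0; apply: (@le_lt_trans _ _ (hausdorff n.-1 (esphere 0 1 : set 'rV[R]_n))).
  exact/le_hausdorff/smooth_spherical_part_sphere/(nozzle_SigmaP nozzleN).
by case: (n) n0 => // k _; exact: hausdorff_sphere_lty.
Qed.

Lemma surface_spherical_section_le r : radiusP N < r ->
  (surface_outer_measure R n (spherical_section N r) <=
   (r ^+ n.-1)%:E * surface_outer_measure R n (SigmaP N))%E.
Proof.
move=> rr; have r0 : 0 < r := lt_trans (nozzle_radiusP nozzleN) rr.
rewrite spherical_sectionE //; apply: hausdorff_lipschitz => // x y.
by rewrite opprD addrACA subrr add0r -scalerBr enormZ gtr0_norm.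
Qed.

(** The part of the nozzle beyond the spherical section of radius r *)
Definition downstream_part (r : R) : set 'rV[R]_n :=
  divergent_part N `&` [set x | r < enorm (x - A)].

(** The part of the nozzle before the spherical section of radius r *)
Definition upstream_part (r : R) : set 'rV[R]_n :=
  domain N `\` (divergent_part N `&` [set x | r <= enorm (x - A)]).

Lemma convergent_part_open : open (convergent_part N).
Proof.
apply: truncated_cone_open; first exact/ltW/(nozzle_radiusM nozzleN).
  exact/smooth_spherical_part_sphere/(nozzle_SigmaM nozzleN).
exact: ssp_open (nozzle_SigmaM nozzleN).
Qed.

Lemma divergent_part_open : open (divergent_part N).
Proof.
apply: truncated_cone_open; first exact/ltW/(nozzle_radiusP nozzleN).
  exact/smooth_spherical_part_sphere/(nozzle_SigmaP nozzleN).
exact: ssp_open (nozzle_SigmaP nozzleN).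
Qed.

Lemma dist_continuous : continuous (fun x : 'rV[R]_n => enorm (x - A)).
Proof.
move=> x; apply: (@continuous_comp _ _ _ (fun x : 'rV[R]_n => x - A)).
  by apply: continuousB => //; exact: cst_continuous.
exact: enorm_continuous.
Qed.

Lemma downstream_part_open r : open (downstream_part r).
Proof.
apply: openI; first exact: divergent_part_open.
exact: ((continuousP _).1 dist_continuous _ (@open_gt R r)).
Qed.

(** Once the throat lies in the ball of radius r about the vertex, the upstream
    part is the union of two open sets: the nozzle inside of this ball and the
    convergent part. *)
Lemma upstream_part_open r :
  (forall x, throat N x -> enorm (x - A) < r) -> open (upstream_part r).
Proof.
move=> throat_r.
have -> : upstream_part r =
    (domain N `&` [set x | enorm (x - A) < r]) `|` convergent_part N.
  apply/seteqP; split=> [x [Dx nx]|x [[Dx xr]|Cx]].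
  - have [xr|rx] := ltP (enorm (x - A)) r; first by left.
    move: (Dx); rewrite (nozzle_decomposition nozzleN) => -[[Px|/throat_r Tx]|]; last by right.
      by case: nx.
    by move: (lt_le_trans Tx rx); rewrite ltxx.
  - by split => // -[_ /= /(lt_le_trans xr)]; rewrite ltxx.
  - split; first by rewrite (nozzle_decomposition nozzleN); right.
    move=> [Px _]; have : (divergent_part N `&` convergent_part N) x by [].
    by rewrite (nozzle_disjoint nozzleN).
apply: openU; last exact: convergent_part_open.
apply: openI; first exact: nozzle_open nozzleN.
exact: ((continuousP _).1 dist_continuous _ (@open_lt R r)).
Qed.

(** The unit normal (x - A) / |x - A|, written as the normalised gradient of
    |x - A|^2, and equal to 0 at the vertex A *)
Definition radial_normal (x : 'rV[R]_n) : 'rV[R]_n :=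
  (enorm (2 *: (x - A)))^-1 *: (2 *: (x - A)).

Lemma cross_section_spherical_section r : (0 < n)%N ->
  radiusP N < r -> (forall x, throat N x -> enorm (x - A) < r) ->
  cross_section N (spherical_section N r) radial_normal.
Proof.
move=> n0 rr throat_r; have r0 : 0 < r := lt_trans (nozzle_radiusP nozzleN) rr.
have PD : divergent_part N `<=` domain N.
  by move=> x Px; rewrite (nozzle_decomposition nozzleN); left; left.
split; first exact: connected_spherical_section.
  apply: le_lt_trans (surface_spherical_section_le rr) _.
  by rewrite lte_mul_pinfty ?lee_fin ?exprn_ge0 ?(ltW r0) ?surface_SigmaP_lty.
exists (upstream_part r), (downstream_part r); split.
- exact: upstream_part_open.
- exact: downstream_part_open.
- apply/seteqP; split => // x [[_ nx] [Px rx]]; apply: nx; split => //=; exact: ltW.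
- apply/seteqP; split => [x [Dx nx]|x [[Dx nx]|[Px rx]]].
  + have [[Px rx]|nPx] := pselect ((divergent_part N `&` [set x | r <= enorm (x - A)]) x).
      right; split => //=; rewrite lt_def rx andbT; apply/eqP => xr.
      by apply: nx; split.
    by left.
  + by split => // -[Px xr]; apply: nx; split => //=; rewrite xr.
  + split; first exact: PD.
    by move=> -[_ xr]; move: rx; rewrite /= xr ltxx.
split.
- by move=> x [Px _]; exact: PD.
- exists 0 => x Cx _; split; first by rewrite (nozzle_decomposition nozzleN); right.
  move=> [Px _]; have : (divergent_part N `&` convergent_part N) x by [].
  by rewrite (nozzle_disjoint nozzleN).
- exists (r + enorm A) => x Px rx; split => //=.
  by have := enormD (x - A) A; rewrite subrK; move: rx; lra.
(* inside of the divergent part, the section is the zero set of |y - A|^2 - r^2 *)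
- move=> x [Px xr]; exists (divergent_part N), (fun y => dotv (y - A) (y - A) - r ^+ 2).
  split => //; [exact: divergent_part_open|exact: dist_sqr_C1|].
  rewrite grad_dist_sqr; split => //.
    rewrite scaler_eq0 negb_or pnatr_eq0 /= -enorm_eq0.
    by move: xr; rewrite /esphere /= => ->; rewrite gt_eqF.
  move=> y Py; rewrite -sqr_enorm.
  have y0 := enorm_ge0 (y - A).
  split.
  + split => [[_ ->]|/eqP]; first by rewrite subrr.
    rewrite subr_eq0 eqrXn2 ?(ltW r0) // => /eqP yr; split => //.
  + rewrite subr_gt0 ltr_pXn2r ?nnegrE ?(ltW r0) //; split => [[_ ry]|ry] //; split.
  + rewrite subr_lt0 ltr_pXn2r ?nnegrE ?(ltW r0) //; split => [[_ ny]|yr].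
      by rewrite ltNge; apply/negP => ry; apply: ny.
    split; first exact: PD.
    by move=> [_ /= ry]; move: (lt_le_trans yr ry); rewrite ltxx.
Qed.

Lemma enorm_radial_normal x : enorm (radial_normal x) <= 1.
Proof.
rewrite /radial_normal; set y := 2 *: _.
rewrite enormZ ger0_norm ?invr_ge0 ?enorm_ge0 //.
have [->|y0] := eqVneq (enorm y) 0; first by rewrite mulr0.
by rewrite mulVf.
Qed.

End spherical_section.

(** * Flux through the spherical sections and lower bound of the speed *)

Lemma exprz_1subn (R : realType) (n : nat) (t : R) :
  (0 < n)%N -> t ^ (1 - n%:Z) = (t ^+ n.-1)^-1.
Proof.
by case: n => // k _; rewrite -[k.+1]addn1 PoszD opprD addrCA subrr addr0 -exprnN addn1.
Qed.

Section flux.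
Context (R : realType) (n : nat) (h : R -> R) (B alpha : R) (N : nozzle R n).
Context (R1 m Lambda : R) (u : 'rV[R]_n -> 'rV[R]_n) (rho : 'rV[R]_n -> R).
Hypotheses (n_gt0 : (0 < n)%N) (nozzleN : is_nozzle alpha N) (m_gt0 : 0 < m).
Hypothesis flow : largely_open_flow h B N R1 m u rho.
Hypothesis rho_le : forall x, far_region N R1 x -> rho x <= Lambda.
Let A := vertexP N.
Let mu := surface_outer_measure R n.

Lemma spherical_section_far r s : s + enorm A <= r ->
  spherical_section N r `<=` far_region N s.
Proof.
move=> sr x [Px xr]; split; first by rewrite (nozzle_decomposition nozzleN); left; left.
by have := enormD x (- A); rewrite enormN xr /=; move: sr; lra.
Qed.

Lemma flux_spherical_section r : radiusP N < r -> R1 + enorm A <= r ->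
  surface_integral (spherical_section N r)
    (fun x => dotv (rho x *: u x) (radial_normal N x)) = m%:E.
Proof.
move=> rr Rr; apply: (flow_flux flow); last exact: spherical_section_far.
apply: (cross_section_spherical_section nozzleN n_gt0 rr) => x Tx.
have := enormD x (- A); rewrite enormN.
by have := flow_R1_large flow Tx; move: Rr; lra.
Qed.

Lemma flux_density_le r x : R1 + enorm A <= r -> spherical_section N r x ->
  dotv (rho x *: u x) (radial_normal N x) <= Lambda * enorm (u x).
Proof.
move=> Rr /(spherical_section_far Rr) Dx.
have rho0 := flow_rho_gt0 flow Dx.
rewrite dotvZl (@le_trans _ _ (rho x * enorm (u x))) //; last first.
  by rewrite ler_wpM2r ?enorm_ge0 ?rho_le.
rewrite ler_pM2l // (le_trans (dotv_le_enorm _ _)) //.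
by rewrite ler_piMr ?enorm_ge0 // enorm_radial_normal.
Qed.

Lemma surface_spherical_section_gt0 r : radiusP N < r -> R1 + enorm A <= r ->
  (0 < mu (spherical_section N r))%E.
Proof.
move=> rr Rr; rewrite lt_neqAle outer_measure_ge0 andbT eq_sym; apply/eqP => mu0.
have := integral_outer_measure0
  (fun x => dotv (rho x *: u x) (radial_normal N x)) mu0.
by rewrite [X in (X <= _)%E](flux_spherical_section rr Rr) lee_fin leNgt m_gt0.
Qed.

Lemma area_SigmaP_gt0 : 0 < area (SigmaP N).
Proof.
apply: fine_gt0; rewrite (surface_SigmaP_lty nozzleN n_gt0) andbT.
rewrite lt_neqAle outer_measure_ge0 andbT eq_sym; apply/eqP => mu0.
pose r := Num.max (radiusP N + 1) (R1 + enorm A).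
have rr : radiusP N < r by rewrite lt_max ltrDl ltr01.
have Rr : R1 + enorm A <= r by rewrite le_max lexx orbT.
have := surface_spherical_section_gt0 rr Rr; apply/negP; rewrite -leNgt.
by have := surface_spherical_section_le nozzleN rr; rewrite mu0 mule0.
Qed.

Lemma exists_speed_ge r : radiusP N < r -> R1 + enorm A <= r ->
  exists2 x, spherical_section N r x &
    m / area (SigmaP N) * enorm (x - A) ^ (1 - n%:Z) <= Lambda * enorm (u x).
Proof.
move=> rr Rr; have r0 : 0 < r := lt_trans (nozzle_radiusP nozzleN) rr.
have a0 := area_SigmaP_gt0; pose c := m / area (SigmaP N) / r ^+ n.-1.
have c0 : 0 < c by rewrite !divr_gt0 ?exprn_gt0.
apply: contrapT => /forall2NP no_x.
have ltc x : spherical_section N r x ->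
    dotv (rho x *: u x) (radial_normal N x) < c.
  move=> Sx; apply: le_lt_trans (flux_density_le Rr Sx) _.
  have [//|/negP] := no_x x; rewrite -ltNge exprz_1subn //.
  by case: Sx => _ ->.
have muSle := surface_spherical_section_le nozzleN rr.
have muSoo : (mu (spherical_section N r) < +oo)%E.
  apply: le_lt_trans muSle _.
  by rewrite lte_mul_pinfty ?lee_fin ?exprn_ge0 ?(ltW r0) ?(surface_SigmaP_lty nozzleN).
have := integral_outer_measure_lt c0 ltc (mu := mu).
rewrite surface_spherical_section_gt0 // muSoo => /(_ isT).
rewrite [X in (X < _)%E](flux_spherical_section rr Rr); apply/negP; rewrite -leNgt.
apply: (@le_trans _ _ (c%:E * ((r ^+ n.-1)%:E * mu (SigmaP N)))%E).
  by rewrite lee_pmul2l.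
have -> : mu (SigmaP N) = (area (SigmaP N))%:E.
  rewrite /area fineK // ge0_fin_numE ?outer_measure_ge0 //.
  exact: surface_SigmaP_lty nozzleN n_gt0.
rewrite -!EFinM lee_fin mulrA divfK ?divfK // gt_eqF // exprn_gt0 //.
Qed.

Lemma not_faster_decay : 0 < Lambda ->
  ~ (forall eps : R, 0 < eps ->
       \forall r \near +oo, forall x, far_region N r x ->
         enorm (u x) <= eps * enorm x ^ (1 - n%:Z)).
Proof.
move=> L0 decay; pose c := m / area (SigmaP N).
have c0 : 0 < c by rewrite divr_gt0 // area_SigmaP_gt0.
(* with |x| >= r / 2 this rate would give Lambda |u| <= (c / 2) r^(1-n) *)
have /decay/filter_ex[s us] : 0 < c / (Lambda * 2 ^+ n.-1 * 2).
  by rewrite divr_gt0 // !mulr_gt0 // exprn_gt0.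
pose r := Num.max (Num.max (radiusP N + 1) (R1 + enorm A))
                  (Num.max (s + enorm A) (2 * enorm A)).
have [rr Rr sr Ar] : [/\ radiusP N < r, R1 + enorm A <= r, s + enorm A <= r
                       & 2 * enorm A <= r].
  by rewrite !le_max !lt_max ltrDl ltr01 !lexx !orbT.
have r0 : 0 < r := lt_trans (nozzle_radiusP nozzleN) rr.
have [x Sx] := exists_speed_ge rr Rr; case: (Sx) => _ xr.
have := us x (spherical_section_far sr Sx).
rewrite xr !exprz_1subn // -/c => ux.
have rx : r / 2 <= enorm x.
  have := enormD x (- A); rewrite enormN xr; lra.
have rk0 : 0 < r ^+ n.-1 by rewrite exprn_gt0.
have xk : (enorm x ^+ n.-1)^-1 <= 2 ^+ n.-1 / r ^+ n.-1.
  rewrite -[leRHS]invf_div lef_pV2 ?posrE ?exprn_gt0 ?divr_gt0 ?(lt_le_trans _ rx) ?divr_gt0 //.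
  by rewrite -expr_div_n lerXn2r ?nnegrE ?enorm_ge0 ?divr_ge0 ?(ltW r0).
apply/negP; rewrite -ltNge.
apply: (@le_lt_trans _ _ (c / r ^+ n.-1 / 2)); last first.
  by rewrite ltr_pdivrMr // ltr_pMr ?ltr1n // divr_gt0.
rewrite -ler_pdivlMl // (le_trans ux) //.
apply: (le_trans (ler_wpM2l _ xk)).
  by rewrite divr_ge0 ?(ltW c0) // !mulr_ge0 ?(ltW L0) // exprn_ge0.
rewrite le_eqVlt; apply/orP; left; apply/eqP; field.
by rewrite !gt_eqF ?exprn_gt0.
Qed.

End flux.

Theorem mainTheorem4 (R : realType) (n : nat) (p h : R -> R) (B qcr : R)
    (alpha : R) (N : nozzle R n) (R1 m Lambda : R)
    (u : 'rV[R]_n -> 'rV[R]_n) (rho : 'rV[R]_n -> R) :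
  (3 <= n)%N ->
  pressure_law p -> enthalpy p h -> critical_speed p h B qcr ->
  0 < alpha < 1 -> is_nozzle alpha N ->
  0 < m -> largely_open_flow h B N R1 m u rho ->
  subsonic qcr (far_region N R1) u ->
  0 < Lambda -> (forall x, far_region N R1 x -> rho x <= Lambda) ->
  (\forall r \near +oo, exists2 x, spherical_section N r x &
     Lambda * enorm (u x) >=
       m / area (SigmaP N) * enorm (x - vertexP N) ^ (1 - n%:Z)) /\
  (* the decay rate |x|^(1-n) cannot be improved to o(|x|^(1-n)) *)
  ~ (forall eps : R, 0 < eps ->
       \forall r \near +oo, forall x, far_region N r x ->
         enorm (u x - state_at_infinity R n) <= eps * enorm x ^ (1 - n%:Z)).
Proof.
move=> n3 _ _ _ _ nozzleN m0 flow _ L0 rhoL.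
have n0 : (0 < n)%N by exact: leq_trans n3.
split.
  near=> r; apply: (exists_speed_ge n0 nozzleN m0 flow rhoL).
    by near: r; apply: nbhs_pinfty_gt; exact: num_real.
  by near: r; apply: nbhs_pinfty_ge; exact: num_real.
move=> decay; apply: (not_faster_decay n0 nozzleN m0 flow rhoL L0) => e e0.
by apply: filterS (decay e e0) => r ur x /ur; rewrite /state_at_infinity subr0.
Unshelve. all: by end_near. Qed.
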